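(* For every distribution $f \in \mathcal D'$, i.e. every continuous linear functional $f : \mathcal D \to \mathbf R$, there exists a distribution $F \in \mathcal T'$, i.e. a continuous linear functional $F:\mathcal T\to\mathbf R$, such that $(F,\varphi)=(f,\varphi)$ for all $\varphi\in\mathcal D\subset\mathcal T$. In other words, any distribution in $\mathcal D'$ can be extended from $\mathcal D$ to $\mathcal T$.
   Context: Let $I=(a,b)\subset\mathbf R$ be a fixed open interval (possibly unbounded; then one-sided limits at $a$ or $b$ are limits at $\mp\infty$) and $J=[-\frac12,\frac12]$. Regulated functions: $\mathbb G(J)$ is the algebra of functions $h:J\to\mathbf R$ having finite one-sided limits $h(s\pm)$ at all interior points of $J$, and $h(-\frac12+)$, $h(\frac12-)$; functions with the same one-sided limits are identified. Sup and absolute-value bounds of elements of $\mathbb G(J)$ are computed via one-sided limits, e.g. $\sup_{s\in J}|h(s)|$ means the supremum of the absolute values of all the one-sided limits of $h$. Dynamic functions: a dynamic function is a map $f$ assigning to each $t\in I$ a function $f(t)(\cdot)$ on $J$ (its dynamic value at $t$). Sums, products and scalar multiples are defined pointwise in $t$ and $s$. If $f(t)(\cdot)$ is constant, $f$ is said to have an ordinary value at $t$, and this constant is denoted $f(t)\in\mathbf R$. For $M\subset I$, $\sup_M|f|=\sup_{t\in M}\sup_{s\in J}|f(t)(s)|$. If $f$ is bounded in a right neighbourhood of $\tau$, then $f(\tau+)=c\in\mathbf R$ means: for every $\varepsilon>0$ there is $\eta>0$ with $\sup_{(\tau,\tau+\eta)}|f-c|<\varepsilon$; $f(\tau-)$,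 $f(a+)$, $f(b-)$ are defined analogously. $d\mathbb G$ is the algebra of dynamic functions $f$ with $f(t)(\cdot)\in\mathbb G(J)$ for all $t\in I$ such that $f(a+)$, $f(b-)$, $f(\tau+)$, $f(\tau-)$ exist for all $\tau\in I$, with norm $\|f\|_{d\mathbb G}=\sup_I|f|$. Test functions: $\operatorname{supp} f$ is the closure in $I$ of $\{t\in I: f(t)(\cdot)\text{ is not ordinary or } f(t)\neq0\}$. $\mathcal T$ is the space of $\varphi\in d\mathbb G$ with compact support in $I$; $\varphi_n\to\varphi$ in $\mathcal T$ means $\varphi_n\to\varphi$ in $d\mathbb G$ and there is a closed interval $[c,d]\subset I$ with $\operatorname{supp}\varphi_n\subset[c,d]$ for all $n$. $\mathcal D$ is the space of real-valued continuous functions on $I$ with compact support in $I$ with its standard topology (convergence: uniform convergence with supports in a common $[c,d]\subset I$). $\mathcal D$ is a subspace of $\mathcal T$ by identifying $\varphi\in\mathcal D$ with the dynamic function having constant dynamic values $\varphi(t)(\cdot)\equiv\varphi(t)$. $\mathcal D'$ and $\mathcal T'$ are the spaces of linear functionals on $\mathcal D$, respectively $\mathcal T$, that are continuous with respect to these convergences. The value of $f$ on $\varphi$ is written $(f,\varphi)$. *)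

(* Defs.v *)
From mathcomp Require Import all_boot all_order all_algebra.
From mathcomp Require Import all_classical all_reals all_analysis.

Set Implicit Arguments.
Unset Strict Implicit.
Unset Printing Implicit Defensive.

Import Order.TTheory GRing.Theory Num.Theory.
Import numFieldNormedType.Exports.

Local Open Scope classical_set_scope.
Local Open Scope ring_scope.

(* Encoding.  A function on an interval X of the line is represented by a total
   function on R, and two representatives are identified when they define the
   same object on X.  Only the values at t in I and the one-sided limits taken
   inside J = [-1/2, 1/2] matter below, so this identification and that of
   regulated functions having the same one-sided limits are handled together
   by the relations [eq_regulated] and [eq_dynamic]. *)

Section Regulated.
Context {R : realType}.
Implicit Types h k : R -> R.

Definition right_lim_at h (s l : R) : Prop :=
  - 2^-1 <= s < 2^-1 /\ h x @[x --> s^'+] --> l.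

Definition left_lim_at h (s l : R) : Prop :=
  - 2^-1 < s <= 2^-1 /\ h x @[x --> s^'-] --> l.

Definition regulated h : Prop :=
  (forall s, - 2^-1 <= s < 2^-1 -> exists l, right_lim_at h s l) /\
  (forall s, - 2^-1 < s <= 2^-1 -> exists l, left_lim_at h s l).

(* Equality in G(J). *)
Definition eq_regulated h k : Prop :=
  forall s l, (right_lim_at h s l <-> right_lim_at k s l) /\
              (left_lim_at h s l <-> left_lim_at k s l).

Definition one_sided_lims h : set R :=
  [set l | exists s, right_lim_at h s l \/ left_lim_at h s l].

Definition supJ h : \bar R :=
  ereal_sup [set `|l|%:E | l in one_sided_lims h].

Definition ordinary_value h (c : R) : Prop := eq_regulated h (fun=> c).

End Regulated.

Section Dynamic.
Context {R : realType}.
Implicit Types (f g : R -> R -> R) (a b x : \bar R).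

Definition ival a b : set R := [set t | (a < t%:E < b)%E].

(* The dynamic value of f at t is f t : R -> R. *)
Definition sup_dyn (M : set R) f : \bar R :=
  ereal_sup [set supJ (f t) | t in M].

(* One-sided neighbourhoods of a point of the extended line; for an infinite
   endpoint eta plays the role of a large bound.  The cases +oo, resp. -oo, of
   the first, resp. second, definition do not occur for I = (a, b), a < b. *)
Definition right_nbhd x (eta : R) : set R :=
  match x with
  | r%:E => [set` `]r, r + eta[]
  | -oo%E => [set` `]-oo, - eta[]
  | +oo%E => set0
  end.

Definition left_nbhd x (eta : R) : set R :=
  match x with
  | r%:E => [set` `]r - eta, r[]
  | +oo%E => [set` `]eta, +oo[]
  | -oo%E => set0
  end.

(* [dyn_rlim a b f x c] is f(x+) = c and [dyn_llim a b f x c] is f(x-) = c;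
   boundedness of f near x follows from the estimate since c is real. *)
Definition dyn_rlim a b f x (c : R) : Prop :=
  forall e : R, 0 < e -> exists eta : R,
    [/\ 0 < eta, right_nbhd x eta `<=` ival a b &
        (sup_dyn (right_nbhd x eta) (fun t s => (f t s - c)%R) < e%:E)%E].

Definition dyn_llim a b f x (c : R) : Prop :=
  forall e : R, 0 < e -> exists eta : R,
    [/\ 0 < eta, left_nbhd x eta `<=` ival a b &
        (sup_dyn (left_nbhd x eta) (fun t s => (f t s - c)%R) < e%:E)%E].

Definition dG a b : set (R -> R -> R) :=
  [set f | [/\ forall t, ival a b t -> regulated (f t),
               exists c, dyn_rlim a b f a c,
               exists c, dyn_llim a b f b c &
               forall tau, ival a b tau ->
                 (exists c, dyn_rlim a b f tau%:E c) /\
                 (exists c, dyn_llim a b f tau%:E c)]].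

Definition eq_dynamic a b f g : Prop :=
  forall t, ival a b t -> eq_regulated (f t) (g t).

Definition norm_dG a b f : \bar R := sup_dyn (ival a b) f.

Definition supp_dyn a b f : set R :=
  closure [set t | ival a b t /\
    (~ (exists c, ordinary_value (f t) c) \/
     exists2 c, ordinary_value (f t) c & c <> 0)] `&` ival a b.

End Dynamic.

Section Test_functions.
Context {R : realType}.
Implicit Types (a b : \bar R).

(* The space T and its convergence. *)
Definition test_dyn a b : set (R -> R -> R) :=
  [set phi | dG a b phi /\ compact (supp_dyn a b phi)].

Definition cvg_test_dyn a b (phi_ : nat -> R -> R -> R) (phi : R -> R -> R) :
    Prop :=
  (fun n => norm_dG a b (fun t s => phi_ n t s - phi t s)) @ \oo --> 0%E /\
  exists c d : R, [/\ c <= d, `[c, d] `<=` ival a b &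
    forall n, supp_dyn a b (phi_ n) `<=` `[c, d]].

(* The space D and its convergence. *)
Definition supp_real a b (phi : R -> R) : set R :=
  closure [set t | ival a b t /\ phi t <> 0] `&` ival a b.

Definition test_cont a b : set (R -> R) :=
  [set phi | {within ival a b, continuous phi} /\
             compact (supp_real a b phi)].

Definition cvg_test_cont a b (phi_ : nat -> R -> R) (phi : R -> R) : Prop :=
  {uniform ival a b, phi_ @ \oo --> phi} /\
  exists c d : R, [/\ c <= d, `[c, d] `<=` ival a b &
    forall n, supp_real a b (phi_ n) `<=` `[c, d]].

(* The embedding of D into T. *)
Definition ordinary_dyn (phi : R -> R) : R -> R -> R := fun t _ => phi t.

(* D' and T': well-defined (on classes of representatives), linear and
   sequentially continuous functionals. *)
Definition distr_cont a b (f : (R -> R) -> R) : Prop :=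
  [/\ forall phi psi, test_cont a b phi -> test_cont a b psi ->
        {in ival a b, phi =1 psi} -> f phi = f psi,
      forall (k : R) phi psi, test_cont a b phi -> test_cont a b psi ->
        f (fun t => k * phi t + psi t) = k * f phi + f psi &
      forall phi_ phi, (forall n, test_cont a b (phi_ n)) ->
        test_cont a b phi -> cvg_test_cont a b phi_ phi ->
        f (phi_ n) @[n --> \oo] --> f phi].

Definition distr_dyn a b (F : (R -> R -> R) -> R) : Prop :=
  [/\ forall phi psi, test_dyn a b phi -> test_dyn a b psi ->
        eq_dynamic a b phi psi -> F phi = F psi,
      forall (k : R) phi psi, test_dyn a b phi -> test_dyn a b psi ->
        F (fun t s => k * phi t s + psi t s) = k * F phi + F psi &
      forall phi_ phi, (forall n, test_dyn a b (phi_ n)) ->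
        test_dyn a b phi -> cvg_test_dyn a b phi_ phi ->
        F (phi_ n) @[n --> \oo] --> F phi].

End Test_functions.

(* D is contained in T: [ordinary_test_dyn]. *)
Section Embedding.
Context {R : realType}.
Implicit Types (a b : \bar R) (phi : R -> R).

Let half_lt : - 2^-1 < 2^-1 :> R.
Proof. by rewrite gtrN // invr_gt0. Qed.

Lemma one_sided_lims_cst (c : R) : one_sided_lims (fun=> c) = [set c].
Proof.
apply/seteqP; split => [l [s [[_ hl]|[_ hl]]]|l ->] /=.
- by rewrite -(cvg_lim _ hl)// lim_cst.
- by rewrite -(cvg_lim _ hl)// lim_cst.
- exists (- 2^-1); left; split; last exact: cvg_cst.
  by rewrite lexx half_lt.
Qed.

Lemma regulated_cst (c : R) : regulated (fun=> c).
Proof. by split=> s hs; exists c; split => //; exact: cvg_cst. Qed.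

Lemma supJ_cst (c : R) : supJ (fun=> c) = `|c|%:E.
Proof. by rewrite /supJ one_sided_lims_cst image_set1 ereal_sup1. Qed.

Lemma ordinary_value_cst (x c : R) : ordinary_value (fun=> x) c <-> x = c.
Proof.
split=> [h|->]; last by move=> s l; split.
have : one_sided_lims (fun=> x) x by rewrite one_sided_lims_cst.
move=> [s [/(h s x).1|/(h s x).2] hl];
  have : one_sided_lims (fun=> c) x by exists s; tauto.
- by rewrite one_sided_lims_cst.
- by rewrite one_sided_lims_cst.
Qed.

Lemma supp_ordinary_dyn a b phi :
  supp_dyn a b (ordinary_dyn phi) = supp_real a b phi.
Proof.
rewrite /supp_dyn /supp_real; congr (closure _ `&` _).
apply/seteqP; split => t /= [It].
- move=> [|[c /ordinary_value_cst -> //]].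
  by move=> []; exists (phi t); apply/ordinary_value_cst.
- by move=> h; split => //; right; exists (phi t) => //; apply/ordinary_value_cst.
Qed.

Lemma sup_ordinary_dyn_lt (M : set R) phi (c e : R) : 0 < e ->
  (forall t, M t -> `|phi t - c| < e / 2) ->
  (sup_dyn M (fun t s => (ordinary_dyn phi t s - c)%R) < e%:E)%E.
Proof.
move=> e0 h; apply: (@le_lt_trans _ _ (e / 2)%:E).
  apply: ge_ereal_sup => _ [t Mt <-].
  by rewrite [supJ _](supJ_cst (phi t - c)) lee_fin ltW// h.
by rewrite lte_fin ltr_pdivrMr// ltr_pMr// ltr1n.
Qed.

Let rfilter (x : \bar R) : set_system R :=
  match x with r%:E => r^'+ | -oo%E => ninfty_nbhs R | +oo%E => fun=> True end.

Let lfilter (x : \bar R) : set_system R :=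
  match x with r%:E => r^'- | +oo%E => pinfty_nbhs R | -oo%E => fun=> True end.

Let rfilterP x (P : set R) : x != +oo%E -> rfilter x P ->
  exists2 eta : R, 0 < eta & right_nbhd x eta `<=` P.
Proof.
case: x => [r| |] //= _.
- move=> /nbhs_ballP[e /= e0 h]; exists e => // t /=.
  rewrite in_itv /= => /andP[rt tr]; apply: h => //.
  by rewrite /ball /= distrC gtr0_norm ?subr_gt0// ltrBlDl.
- move=> [M [_ h]]; exists (`|M| + 1) => [|t /=]; first by rewrite ltr_wpDl.
  rewrite in_itv /= => tM; apply: h; apply: (lt_le_trans tM).
  by rewrite lerNl (le_trans (ler_norm _))// normrN lerDl.
Qed.

Let lfilterP x (P : set R) : x != -oo%E -> lfilter x P ->
  exists2 eta : R, 0 < eta & left_nbhd x eta `<=` P.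
Proof.
case: x => [r| |] //= _.
- move=> /nbhs_ballP[e /= e0 h]; exists e => // t /=.
  rewrite in_itv /= => /andP[rt tr]; apply: h => //.
  by rewrite /ball /= gtr0_norm ?subr_gt0// ltrBlDl -ltrBlDr.
- move=> [M [_ h]]; exists (`|M| + 1) => [|t /=]; first by rewrite ltr_wpDl.
  rewrite in_itv /= andbT => tM; apply: h; apply: le_lt_trans tM.
  by rewrite (le_trans (ler_norm _))// lerDl.
Qed.

Let near_ival a b t : ival a b t -> \forall u \near t, ival a b u.
Proof.
move=> /andP[at_ tb].
have A : \forall u \near t, (a < u%:E)%E.
  case: a at_ => [r| |] //; last by move=> _; apply: (@filterE _ (nbhs t)) => u; rewrite ltNyr.
  by rewrite lte_fin => rt; apply: (@filterS _ (nbhs t) _ [set u | r < u]) => [u|]; [by rewrite lte_fin|exact: lt_nbhsr].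
have B : \forall u \near t, (u%:E < b)%E.
  case: b tb => [r| |] //; last by move=> _; apply: (@filterE _ (nbhs t)) => u; rewrite ltry.
  by rewrite lte_fin => rt; apply: (@filterS _ (nbhs t) _ [set u | u < r]) => [u|]; [by rewrite lte_fin|exact: lt_nbhsl].
by move: A B; apply: filterS2 => u au ub; apply/andP.
Qed.

Let rival a b : (a < b)%E -> rfilter a (ival a b).
Proof.
case: a => [r| |] //=; last first.
  case: b => [r| |] //= _.
    by exists r; split => [|x xr]; [exact: num_real| by rewrite /ival /= ltNyr lte_fin].
  by exists 0; split => // x xr; rewrite /ival /= ltNyr ltry.
case: b => [s| |] //= rs; rewrite /ival /=.
  near=> x; rewrite /mkset /= !lte_fin; apply/andP; split; near: x.
    exact: nbhs_right_gt.
  exact: nbhs_right_lt.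
near=> x; rewrite /mkset /= lte_fin ltry andbT; near: x; exact: nbhs_right_gt.
Unshelve. all: end_near. Qed.

Let lival a b : (a < b)%E -> lfilter b (ival a b).
Proof.
case: b => [r| |]; first last.
- by move=> abs; exfalso; move: abs; rewrite ltNge leNye.
- case: a => [r| |] //= _.
    by exists r; split => [|x xr]; [exact: num_real| by rewrite /ival /= ltry lte_fin xr].
  by exists 0; split => // x xr; rewrite /ival /= ltNyr ltry.
case: a => [s| |] //= rs; rewrite /ival /=.
  near=> x; rewrite /mkset /= !lte_fin; apply/andP; split; near: x.
    by apply: nbhs_left_gt; rewrite -lte_fin.
  exact: nbhs_left_lt.
near=> x; rewrite /mkset /= lte_fin ltNyr /=; near: x; exact: nbhs_left_lt.
Unshelve. all: end_near. Qed.

Let rsupp a b (K : set R) : (a < b)%E -> compact K -> K `<=` ival a b ->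
  rfilter a (~` K).
Proof.
move=> ab cK KI; case: a ab KI => [r| |] //= ab KI; last first.
  have [M [_ hM]] := compact_bounded cK.
  exists (- (M + 1)); split; first exact: num_real.
  move=> x xM Kx; have /(_ (M + 1)) := hM; rewrite ltrDl ltr01 => /(_ isT x Kx).
  by apply/negP; rewrite -ltNge -normrN (lt_le_trans _ (ler_norm _))// ltrNr.
have oK : open (~` K) by apply: closed_openC; exact: (compact_closed _ cK).
apply: (@filterS _ (nbhs r) _ (~` K)) => [x nKx _ //|].
apply: open_nbhs_nbhs; split => // /KI.
by rewrite /ival /= ltxx.
Qed.

Let lsupp a b (K : set R) : (a < b)%E -> compact K -> K `<=` ival a b ->
  lfilter b (~` K).
Proof.
move=> ab cK KI; case: b ab KI => [r| |] //= ab KI; last first.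
  have [M [_ hM]] := compact_bounded cK.
  exists (M + 1); split; first exact: num_real.
  move=> x xM Kx; have /(_ (M + 1)) := hM; rewrite ltrDl ltr01 => /(_ isT x Kx).
  by apply/negP; rewrite -ltNge (lt_le_trans xM)// ler_norm.
have oK : open (~` K) by apply: closed_openC; exact: (compact_closed _ cK).
apply: (@filterS _ (nbhs r) _ (~` K)) => [x nKx _ //|].
apply: open_nbhs_nbhs; split => // /KI.
by rewrite /ival /= ltxx andbF.
Qed.

Let supp_real0 a b phi t : ival a b t -> ~ supp_real a b phi t -> phi t = 0.
Proof.
move=> It h; apply: contrapT => p0; apply: h; split => //.
by apply: subset_closure.
Qed.

Lemma ordinary_test_dyn a b phi : (a < b)%E ->
  test_cont a b phi -> test_dyn a b (ordinary_dyn phi).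
Proof.
move=> ab [cphi cK]; split; last by rewrite supp_ordinary_dyn.
have KI : supp_real a b phi `<=` ival a b by move=> t [].
have ctau (tau : R) (e : R) : ival a b tau -> 0 < e ->
    \forall t \near tau, ival a b t /\ `|phi t - phi tau| < e / 2.
  move=> It e0; have A := near_ival It.
  have /cvgrPdist_lt/(_ (e / 2)) := (subspace_continuousP _ _).1 cphi _ It.
  rewrite divr_gt0// => /(_ isT) B.
  apply: (@filterS2 _ (nbhs tau) _ _ _ _ _ A B) => t Itt h.
  by split => //; rewrite distrC; exact: h.
split=> [t _| | |tau It].
- exact: regulated_cst.
- exists 0 => e e0.
  have fa : Filter (rfilter a).
    by case: (a) ab => [r| |] //= ab'; exact: _.
  have [||eta eta0 h] := @rfilterP a (ival a b `&` ~` supp_real a b phi).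
  + by rewrite -ltey (lt_le_trans ab)// leey.
  + by apply: filterI; [exact: rival|exact: (rsupp ab cK KI)].
  exists eta; split => // [t /h[]//|].
  apply: sup_ordinary_dyn_lt => // t /h[It /(supp_real0 It) ->].
  by rewrite subr0 normr0 divr_gt0.
- exists 0 => e e0.
  have fb : Filter (lfilter b).
    case: (b) ab => [r| |] ab'; [exact: at_left_proper_filter|exact: proper_pinfty_nbhs|].
    by move: ab'; rewrite ltNge leNye.
  have [||eta eta0 h] := @lfilterP b (ival a b `&` ~` supp_real a b phi).
  + by rewrite -ltNye (le_lt_trans _ ab)// leNye.
  + by apply: filterI; [exact: lival|exact: (lsupp ab cK KI)].
  exists eta; split => // [t /h[]//|].
  apply: sup_ordinary_dyn_lt => // t /h[It /(supp_real0 It) ->].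
  by rewrite subr0 normr0 divr_gt0.
- split; exists (phi tau) => e e0.
  + have [||eta eta0 h] := @rfilterP tau%:E
      [set t | ival a b t /\ `|phi t - phi tau| < e / 2] => //.
      by apply: (@filterS _ (nbhs tau) _ _ _ _ (ctau _ _ It e0)) => t.
    exists eta; split => // [t /h[]//|].
    by apply: sup_ordinary_dyn_lt => // t /h[].
  + have [||eta eta0 h] := @lfilterP tau%:E
      [set t | ival a b t /\ `|phi t - phi tau| < e / 2] => //.
      by apply: (@filterS _ (nbhs tau) _ _ _ _ (ctau _ _ It e0)) => t.
    exists eta; split => // [t /h[]//|].
    by apply: sup_ordinary_dyn_lt => // t /h[].
Qed.

End Embedding.

(* Main.v *)
Require Import Defs.
From mathcomp Require Import all_boot all_order all_algebra.
From mathcomp Require Import all_classical all_reals all_analysis.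
From mathcomp Require Import ring lra.

(* For phi in T let e(phi)(t) be the one-sided limit phi(t)(-1/2+); it is a
   bounded function of t with compact support in I, depending linearly on phi.
   Interpolating it piecewise linearly on the grid of mesh 1/(n+1) gives
   A_n phi in D for n large, with supports in a fixed compact interval and
   sup |A_n phi| <= ||phi||.  Since f is bounded by a multiple of the sup norm
   on functions supported in a given [c, d], the sequence f(A_n phi) is
   bounded, and its limit along a fixed nonprincipal ultrafilter on nat is a
   continuous linear functional of phi.  It extends f because A_n phi -> phi
   uniformly when phi is in D. *)

Import Order.TTheory GRing.Theory Num.Theory.
Import numFieldNormedType.Exports.

Local Open Scope classical_set_scope.
Local Open Scope ring_scope.

(** * Piecewise linear interpolation on uniform grids *)

Section Interpolation.
Context {R : realType}.
Implicit Types (g h : R -> R) (x y t c d M e : R).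

Definition ramp x : R := Num.max 0 (Num.min 1 (x + 1)).

(* The tent max(0, 1 - |x|), in a form that makes its integer translates
   telescope. *)
Definition tent x : R := ramp x - ramp (x - 1).

(** For [k] up to [2(n+1)^2] the nodes run from [-(n+1)] to [n+1]: the window grows as the mesh
    shrinks, so one sequence of grids serves every compact support. *)
Definition node (n k : nat) : R := k%:R / n.+1%:R - n.+1%:R.

Definition node_weight (n k : nat) t : R := tent (n.+1%:R * (t - node n k)).

(* Piecewise linear interpolation of g on the grid of mesh 1/(n+1) in
   [-(n+1), n+1]. *)
Definition interpolate (n : nat) g t : R :=
  \sum_(k < (n.+1 ^ 2).*2.+1) node_weight n k t * g (node n k).

Lemma ramp0 x : x <= -1 -> ramp x = 0.
Proof.
move=> x1; rewrite /ramp (min_r _)//; last lra.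
by rewrite max_l//; lra.
Qed.

Lemma ramp1 x : 0 <= x -> ramp x = 1.
Proof. by move=> x0; rewrite /ramp (min_l _) ?max_r//; lra. Qed.

Lemma ramp_itv x : 0 <= ramp x <= 1.
Proof. by rewrite /ramp le_max lexx /= ge_max ler01 /= ge_min lexx. Qed.

Lemma ramp_le x y : x <= y -> ramp x <= ramp y.
Proof.
move=> xy; rewrite /ramp ge_max !le_max lexx /=; apply/orP; right.
by rewrite le_min !ge_min lexx /= lerD2r xy orbT.
Qed.

Lemma tent_ge0 x : 0 <= tent x.
Proof. by rewrite subr_ge0; apply: ramp_le; lra. Qed.

Lemma tent_eq0 x : 1 <= `|x| -> tent x = 0.
Proof.
rewrite ler_normr /tent => /orP[x1|x1]; first by rewrite !ramp1 ?subrr//; lra.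
by rewrite !ramp0 ?subrr//; lra.
Qed.

Lemma continuous_ramp : continuous ramp.
Proof.
move=> x; apply: (@continuous_max _ _ (cst 0) (cst 1 \min (fun y => y + 1))).
  exact: cvg_cst.
apply: continuous_min; first exact: cvg_cst.
by apply: cvgD; [exact: cvg_id|exact: cvg_cst].
Qed.

Lemma continuous_node_weight n k : continuous (node_weight n k).
Proof.
have affine e : continuous (fun t => n.+1%:R * (t - node n k) - e).
  move=> x; apply: cvgB; last exact: cvg_cst.
  by apply: cvgM; [exact: cvg_cst|apply: cvgB; [exact: cvg_id|exact: cvg_cst]].
move=> x; apply: cvgB; last exact: continuous_comp (affine 1 x) (continuous_ramp _).
under eq_fun do rewrite -[X in ramp X]subr0.
rewrite -[X in ramp X]subr0.
exact: continuous_comp (affine 0 x) (continuous_ramp _).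
Qed.

Lemma continuous_interpolate n g : continuous (interpolate n g).
Proof.
apply: continuous_big => [|k _ x]; first exact: add_continuous.
by apply: cvgM; [exact: continuous_node_weight|exact: cvg_cst].
Qed.

Lemma node_weight_eq0 n k t :
  n.+1%:R^-1 <= `|t - node n k| -> node_weight n k t = 0.
Proof.
move=> h; apply: tent_eq0; rewrite normrM ger0_norm// mulrC -ler_pdivrMr//.
by rewrite div1r.
Qed.

Lemma node_weight_ge0 n k t : 0 <= node_weight n k t.
Proof. exact: tent_ge0. Qed.

(** Moving to the next node lowers the argument of [ramp] by 1, so each weight is a difference
    [u k.+1 - u k] and the sum telescopes. *)
Lemma sum_node_weight n t :
  \sum_(k < (n.+1 ^ 2).*2.+1) node_weight n k t =
    ramp (n.+1%:R * (t + n.+1%:R)) - ramp (n.+1%:R * (t - n.+1%:R) - 1).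
Proof.
pose u (k : nat) := - ramp (n.+1%:R * (t + n.+1%:R) - k%:R).
have n0 : (n.+1%:R : R) != 0 by rewrite pnatr_eq0.
rewrite -(big_mkord xpredT (node_weight n ^~ t)).
rewrite (eq_bigr (fun k => u k.+1 - u k)) => [|k _]; last first.
  rewrite /node_weight /tent /u opprK addrC; congr (- ramp _ + ramp _).
    by rewrite /node -natr1; field.
  by rewrite /node; field.
rewrite telescope_sumr// /u opprK addrC subr0; congr (_ - ramp _).
rewrite -[X in _ - X]natr1 -muln2 natrM natrX; ring.
Qed.

Lemma sum_node_weight_le1 n t :
  \sum_(k < (n.+1 ^ 2).*2.+1) node_weight n k t <= 1.
Proof.
rewrite sum_node_weight.
have /andP[_ h1] := ramp_itv (n.+1%:R * (t + n.+1%:R)).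
have /andP[h2 _] := ramp_itv (n.+1%:R * (t - n.+1%:R) - 1).
lra.
Qed.

Lemma sum_node_weight_eq1 n t : `|t| <= n.+1%:R ->
  \sum_(k < (n.+1 ^ 2).*2.+1) node_weight n k t = 1.
Proof.
rewrite ler_norml => /andP[t1 t2]; rewrite sum_node_weight.
rewrite ramp1 ?ramp0 ?subr0//.
  by rewrite gerDr mulr_ge0_le0// subr_le0.
by rewrite mulr_ge0// -lerBlDr sub0r.
Qed.

Lemma interpolate_lin n k g h t :
  interpolate n (fun x => k * g x + h x) t =
  k * interpolate n g t + interpolate n h t.
Proof.
rewrite /interpolate mulr_sumr -big_split/=.
by apply: eq_bigr => i _; rewrite mulrDr mulrCA.
Qed.

(** The interpolant combines values of [g] with nonnegative weights of sum at most 1. *)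
Lemma interpolate_norm n g M t : (forall x, `|g x| <= M) ->
  `|interpolate n g t| <= M.
Proof.
move=> gM; have M0 : 0 <= M by apply: le_trans (gM 0).
apply: (le_trans (ler_norm_sum _ _ _)).
apply: (@le_trans _ _ (\sum_(k < (n.+1 ^ 2).*2.+1) node_weight n k t * M)).
  by apply: ler_sum => k _; rewrite normrM (ger0_norm (node_weight_ge0 _ _ _))
       ler_wpM2l ?node_weight_ge0.
by rewrite -mulr_suml ler_piMl// sum_node_weight_le1.
Qed.

(** Nodes outside [[c, d]] carry the value 0; nodes inside are at least one mesh away from [t],
    where the tent vanishes. *)
Lemma interpolate_eq0 n g c d t :
  (forall x, x \notin `[c, d] -> g x = 0) ->
  t \notin `[c - n.+1%:R^-1, d + n.+1%:R^-1] -> interpolate n g t = 0.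
Proof.
move=> g0 tn; apply: big1 => k _.
have [xcd|/g0 ->] := boolP (node n k \in `[c, d]); last by rewrite mulr0.
rewrite node_weight_eq0 ?mul0r//.
move: xcd tn; rewrite !in_itv /= negb_and -!ltNge => /andP[h1 h2].
by move: (n.+1%:R^-1 : R) => e /orP[h|h]; rewrite ler_normr; apply/orP; [right|left]; lra.
Qed.

(* Outside [-(n+1), n+1] the weights need not add up to 1. *)
Lemma interpolate_dist n g t e : 0 <= e ->
  (`|t| <= n.+1%:R \/ g t = 0) ->
  (forall x, `|t - x| < n.+1%:R^-1 -> `|g x - g t| <= e) ->
  `|interpolate n g t - g t| <= e.
Proof.
move=> e0 tn ge.
have -> : interpolate n g t - g t =
    \sum_(k < (n.+1 ^ 2).*2.+1) node_weight n k t * (g (node n k) - g t).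
  under eq_bigr do rewrite mulrBr.
  rewrite big_split/= sumrN -mulr_suml; congr (_ - _).
  by case: tn => [/sum_node_weight_eq1 ->|->]; rewrite ?mul1r ?mulr0.
apply: (le_trans (ler_norm_sum _ _ _)).
apply: (@le_trans _ _ (\sum_(k < (n.+1 ^ 2).*2.+1) node_weight n k t * e)).
  apply: ler_sum => k _; rewrite normrM (ger0_norm (node_weight_ge0 _ _ _)).
  have [h|h] := ltP `|t - node n k| n.+1%:R^-1.
    by rewrite ler_wpM2l ?node_weight_ge0// ge.
  by rewrite node_weight_eq0// !mul0r.
by rewrite -mulr_suml ler_piMl// sum_node_weight_le1.
Qed.

End Interpolation.

(** * Supports in [I], boundedness of [f], and convergence along ultrafilters *)

Section Extension.
Context {R : realType} {a b : \bar R}.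
Implicit Types (f : (R -> R) -> R) (g h phi : R -> R) (c d M e : R).

(** Required on the whole line, not just on [I]: interpolation also samples [g] at nodes outside
    [I]. *)
Definition vanishes_off c d g := forall x, x \notin `[c, d] -> g x = 0.

Lemma ival_itv c d : ival a b c -> ival a b d -> `[c, d] `<=` ival a b.
Proof.
move=> /andP[ac _] /andP[_ db] x; rewrite /= in_itv /= => /andP[cx xd].
by apply/andP; split; [apply: lt_le_trans ac _|apply: le_lt_trans db]; rewrite lee_fin.
Qed.

Lemma lte_subr_gt0 c : (a < c%:E)%E -> exists2 e, 0 < e & (a < (c - e)%:E)%E.
Proof.
case: a => [r| |] //; last by exists 1; rewrite ?ltr01// ltNyr.
rewrite lte_fin => rc; exists ((c - r) / 2); first by rewrite divr_gt0// subr_gt0.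
by rewrite lte_fin; lra.
Qed.

Lemma lte_addr_gt0 d : (d%:E < b)%E -> exists2 e, 0 < e & ((d + e)%:E < b)%E.
Proof.
case: b => [r| |] //; last by exists 1; rewrite ?ltr01// ltry.
rewrite lte_fin => rc; exists ((r - d) / 2); first by rewrite divr_gt0// subr_gt0.
by rewrite lte_fin; lra.
Qed.

(** The margin [e] leaves room for the supports of interpolants, which may be wider by one mesh on
    each side. *)
Lemma ival_expand c d : ival a b c -> ival a b d ->
  exists2 e, 0 < e & `[c - e, d + e] `<=` ival a b.
Proof.
move=> Ic Id; have /andP[/lte_subr_gt0[e1 e10 h1] cb] := Ic.
have /andP[ad /lte_addr_gt0[e2 e20 h2]] := Id.
exists (Num.min e1 e2); first by rewrite lt_min e10.
apply: ival_itv; apply/andP; split.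
- by apply: (lt_le_trans h1); rewrite lee_fin lerD2l lerN2 ge_min lexx.
- by apply: le_lt_trans cb; rewrite lee_fin gerBl le_min !ltW.
- by apply: (lt_le_trans ad); rewrite lee_fin lerDl le_min !ltW.
- by apply: le_lt_trans h2; rewrite lee_fin lerD2l ge_min lexx orbT.
Qed.

Lemma ival_near t : ival a b t -> nbhs t (ival a b).
Proof.
move=> It; have [e e0 h] := ival_expand _ _ It It.
apply/nbhs_ballP; exists e => //= u; rewrite /ball /= => tu; apply: h.
rewrite /= in_itv /=; move: tu; rewrite ltr_norml => /andP[h1 h2].
by apply/andP; split; lra.
Qed.

Lemma closure_vanishes c d g : vanishes_off c d g ->
  closure [set t | ival a b t /\ g t <> 0] `<=` `[c, d].
Proof.
move=> g0 t gt; have : closed [set` `[c, d]] by exact: itv_closed.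
apply; apply: closureS gt => x [_ gx] /=.
by apply: contrapT => /negP/g0.
Qed.

Lemma supp_real_vanishes c d g :
  vanishes_off c d g -> supp_real a b g `<=` `[c, d].
Proof. by move=> /closure_vanishes sub t [/sub]. Qed.

Lemma test_cont_vanishes c d g : `[c, d] `<=` ival a b ->
  continuous g -> vanishes_off c d g -> test_cont a b g.
Proof.
move=> cdI gc /closure_vanishes sub; split; first exact: continuous_subspaceT.
rewrite /supp_real setIidl; last exact: subset_trans sub cdI.
apply: (subclosed_compact _ (segment_compact (a := c) (b := d))) => //.
exact: closed_closure.
Qed.

Lemma cvg_uniform_norm (A : set R) (g_ : nat -> R -> R) g :
  (forall e, 0 < e -> \forall n \near \oo, forall x, A x -> `|g_ n x - g x| <= e) ->
  {uniform A, g_ @ \oo --> g}.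
Proof.
move=> H W /uniform_nbhs[E [+ EW]]; rewrite -entourage_ballE => -[e /= e0 sub].
have e20 : 0 < e / 2 by rewrite divr_gt0.
apply: filterS (H _ e20) => n hn; apply: EW => x Ax.
apply: sub; rewrite /ball /= distrC (le_lt_trans (hn _ Ax))//.
by rewrite gtr_pMr// invf_lt1// ltr1n.
Qed.

Lemma distr_cont0 f : distr_cont a b f -> test_cont a b (cst 0) -> f (cst 0) = 0.
Proof.
move=> [_ lin _] t0; have := lin (-1) _ _ t0 t0.
rewrite mulN1r addNr; apply: etrans; congr f.
by apply/funext => x /=; rewrite mulr0 addr0.
Qed.

Lemma distr_contZ f k g : distr_cont a b f -> test_cont a b (cst 0) ->
  test_cont a b g -> f (fun t => k * g t) = k * f g.
Proof.
move=> hf t0 tg; have [_ lin _] := hf; have := lin k _ _ tg t0.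
rewrite distr_cont0// addr0; apply: etrans; congr f.
by apply/funext => x /=; rewrite addr0.
Qed.

(** Sequential continuity forces boundedness: if every constant [n.+1] fails for some [h_ n],
    dividing by [f (h_ n)] gives a null sequence on which [f] is constantly 1. *)
Lemma distr_cont_bounded f c d : distr_cont a b f -> c <= d ->
  `[c, d] `<=` ival a b ->
  exists2 C : R, 0 <= C & forall g M, continuous g -> vanishes_off c d g ->
    (forall x, `|g x| <= M) -> `|f g| <= C * M.
Proof.
move=> hf cd cdI; apply: contrapT => nC.
have t0 : test_cont a b (cst 0).
  by apply: (test_cont_vanishes c d) => [//|x|x _ //]; exact: cvg_cst.
have /choice[h_ hh] (n : nat) : exists h, exists M, [/\ continuous h,
    vanishes_off c d h, forall x, `|h x| <= M & n.+1%:R * M < `|f h|].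
  apply: contrapT => nh; apply: nC; exists n.+1%:R => // g M gc g0 gM.
  by rewrite leNgt; apply/negP => fg; apply: nh; exists g, M.
pose psi n t := (f (h_ n))^-1 * h_ n t.
have fh0 n : f (h_ n) != 0.
  have [M [_ _ hM Mf]] := hh n; rewrite -normr_gt0 (le_lt_trans _ Mf)// mulr_ge0//.
  exact: le_trans (hM 0).
have ptest n : test_cont a b (psi n).
  have [M [hc h0 _ _]] := hh n; apply: (test_cont_vanishes c d) => //.
    by move=> x; apply: cvgM; [exact: cvg_cst|exact: hc].
  by move=> x /h0; rewrite /psi => ->; rewrite mulr0.
have fpsi n : f (psi n) = 1.
  have [M [hc h0 _ _]] := hh n; rewrite distr_contZ ?mulVf//.
  exact: (test_cont_vanishes c d).
have [_ _ /(_ psi _ ptest t0)] := hf.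
have cvg : cvg_test_cont a b psi (cst 0).
  split; last first.
    exists c, d; split => // n; apply: supp_real_vanishes => // x xn.
    by have [M [_ h0 _ _]] := hh n; rewrite /psi h0// mulr0.
  apply: cvg_uniform_norm => e e0.
  near=> n => x _; rewrite subr0 /psi.
  have [M [_ _ hM Mf]] := hh n.
  rewrite normrM normfV mulrC ler_pdivrMr ?normr_gt0//.
  (* Since [n.+1 * M] is below the absolute value of [f (h_ n)], it is enough that
     [1 / n.+1 <= e]. *)
  apply: (le_trans (hM x)); rewrite -ler_pdivrMl//.
  have M0 : 0 <= M by apply: le_trans (hM 0).
  apply: ltW; apply: le_lt_trans Mf; apply: ler_wpM2r => //.
  apply: ltW; rewrite -[ltRHS]invrK ltf_pV2 ?posrE ?invr_gt0//.
  near: n; exact: near_infty_natSinv_lt (PosNum e0).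
move=> /(_ cvg).
under eq_cvg do rewrite fpsi.
rewrite distr_cont0//.
move=> /cvg_lim; rewrite lim_cst// => /(_ (@Rhausdorff R))/eqP.
by rewrite oner_eq0.
Unshelve. all: end_near. Qed.

(** By compactness the image filter clusters at some [p]; an ultrafilter contains the preimage of
    each neighbourhood of [p] or of its complement, and clustering excludes the latter. *)
Lemma ultra_bounded_cvg (U : set_system nat) (u : nat -> R) M : UltraFilter U ->
  (\forall n \near U, `|u n| <= M) -> cvg (u n @[n --> U]).
Proof.
move=> UU uM.
have [p [_ clp]] : `[- M, M] `&` cluster (u n @[n --> U]) !=set0.
  apply: (segment_compact (a := - M) (b := M)).
  by apply: filterS uM => n; rewrite ler_norml /= in_itv.
apply/cvg_ex; exists p => V pV.
have [//|UV] := in_ultra_setVsetC (u @^-1` V) UU.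
have [|q [/= nVq Vq]] := clp (~` V) V _ pV; first by [].
by [].
Qed.

(** One interval [[c', d']] works for all [g] and all large [n]: convergence in D and the bound on
    [f] both ask for a common support. *)
Lemma vanishes_interpolate c d : ival a b c -> ival a b d -> c <= d ->
  exists c' d', [/\ c' <= d', `[c', d'] `<=` ival a b &
    \forall n \near \oo, forall g, vanishes_off c d g ->
      vanishes_off c' d' (interpolate n g)].
Proof.
move=> Ic Id cd; have [e e0 h] := ival_expand _ _ Ic Id.
exists (c - e), (d + e); split => //; first by lra.
near=> n => g g0 t tn; apply: (interpolate_eq0 n g c d t g0).
apply: contra tn; rewrite !in_itv /= => /andP[h1 h2].
have : n.+1%:R^-1 < e by near: n; exact: near_infty_natSinv_lt (PosNum e0).
by move: (n.+1%:R^-1 : R) h1 h2 => u h1 h2 ue; apply/andP; split; lra.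
Unshelve. all: end_near. Qed.

(** Heine-Cantor, with the mesh as modulus of continuity. A pair with a point in [[c, d]] is treated
    from that point; a pair with none has both values 0. *)
Lemma unif_continuous_vanishes c d g e : vanishes_off c d g ->
  (forall x, x \in `[c, d] -> {for x, continuous g}) -> 0 < e ->
  \forall n \near \oo, forall x y, `|x - y| < n.+1%:R^-1 -> `|g x - g y| <= e.
Proof.
move=> g0 gc e0.
have e20 : 0 < e / 2 by rewrite divr_gt0.
have : \forall n \near \oo, [set` `[c, d]] `<=`
    [set x | forall y, `|x - y| < n.+1%:R^-1 -> `|g x - g y| <= e].
  apply: (compact_near_coveringP _).1; first exact: segment_compact.
  move=> x /gc /cvgrPdist_lt/(_ _ e20)/nbhs_ballP[r /= r0 hr].
  (* The radius is halved so that a point within [r / 2] of the smaller ball stays in [ball x r]. *)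
  have r20 : 0 < r / 2 by rewrite divr_gt0.
  exists (ball x (r / 2), [set n | n.+1%:R^-1 < r / 2]).
    split; [exact: nbhsx_ballx|exact: near_infty_natSinv_lt (PosNum r20)].
  case=> x' n [/=]; rewrite /ball /= => xx' nr y x'y.
  have /hr h1 : ball x r x' by rewrite /ball /=; lra.
  have /hr h2 : ball x r y.
    rewrite /ball /= -(subrKA x') (le_lt_trans (ler_normD _ _))//.
    by move: (n.+1%:R^-1 : R) nr x'y => u; lra.
  rewrite -(subrKA (g x)) (le_trans (ler_normD _ _))// [X in X + _]distrC; lra.
apply: filterS => n hn x y xy.
have [xcd|xn] := boolP (x \in `[c, d]); first exact: hn.
have [ycd|yn] := boolP (y \in `[c, d]); 
  first by rewrite distrC; apply: hn => //; rewrite distrC.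
by rewrite !g0// subrr normr0 ltW.
Qed.

End Extension.

(** * The limit of [f] on interpolants along an ultrafilter *)

Section UltraLimit.
Context {R : realType} (a b : \bar R) (f : (R -> R) -> R) (U : set_system nat).
Context (hf : distr_cont a b f) (UU : UltraFilter U) (oU : \oo `<=` U).
Implicit Types (g h phi : R -> R) (c d M e : R).

(** [lim] is total; [ultra_ext_cvg] shows that this is a genuine limit when [g] satisfies
    [bounded_support]. *)
Definition ultra_ext g : R := lim (f (interpolate n g) @[n --> U]).

Definition bounded_support g := exists c d M, [/\ c <= d, ival a b c,
  ival a b d, vanishes_off c d g & forall x, `|g x| <= M].

Lemma test_cont_interpolate g : bounded_support g ->
  \forall n \near \oo, test_cont a b (interpolate n g).
Proof.
move=> [c [d [M [cd Ic Id g0 _]]]].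
have [c' [d' [_ sub near0]]] := vanishes_interpolate c d Ic Id cd.
apply: filterS near0 => n /(_ _ g0); apply: test_cont_vanishes => //.
exact: continuous_interpolate.
Qed.

(** [C] and the threshold on [n] depend on [c] and [d] only, because interpolation preserves the
    bound [M]; the continuity of the extension rests on this uniformity. *)
Lemma ultra_ext_bounded_near c d : c <= d -> ival a b c -> ival a b d ->
  exists2 C, 0 <= C & \forall n \near \oo, forall g M, vanishes_off c d g ->
    (forall x, `|g x| <= M) -> `|f (interpolate n g)| <= C * M.
Proof.
move=> cd Ic Id.
have [c' [d' [cd' sub near0]]] := vanishes_interpolate c d Ic Id cd.
have [C C0 hC] := distr_cont_bounded f c' d' hf cd' sub.
exists C => //; apply: filterS near0 => n n0 g M g0 gM.
apply: hC; [exact: continuous_interpolate|exact: n0|].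
by move=> x; apply: interpolate_norm.
Qed.

Lemma ultra_ext_cvg g : bounded_support g ->
  f (interpolate n g) @[n --> U] --> ultra_ext g.
Proof.
move=> [c [d [M [cd Ic Id g0 gM]]]].
have [C _ hC] := ultra_ext_bounded_near c d cd Ic Id.
apply: (ultra_bounded_cvg U _ (C * M)).
by apply: oU; apply: filterS hC => n; apply.
Qed.

(** Interpolants are known to lie in D, where [f] is linear, only for large [n]; this suffices
    because [U] refines [\oo]. *)
Lemma ultra_ext_lin k g h : bounded_support g -> bounded_support h ->
  ultra_ext (fun t => k * g t + h t) = k * ultra_ext g + ultra_ext h.
Proof.
move=> bg bh; apply: cvg_lim; first exact: Rhausdorff.
have : k * f (interpolate n g) + f (interpolate n h) @[n --> U] -->
    k * ultra_ext g + ultra_ext h.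
  by apply: cvgD; [apply: cvgM; [exact: cvg_cst|]|]; exact: ultra_ext_cvg.
apply: cvg_trans; apply: near_eq_cvg; apply: oU.
apply: filterS2 (test_cont_interpolate _ bg) (test_cont_interpolate _ bh) => n tg th.
have [_ lin _] := hf; rewrite -lin//; congr f.
by apply/funext => t; rewrite interpolate_lin.
Qed.

Lemma ultra_ext_bounded c d : c <= d -> ival a b c -> ival a b d ->
  exists2 C, 0 <= C & forall g M, vanishes_off c d g ->
    (forall x, `|g x| <= M) -> `|ultra_ext g| <= C * M.
Proof.
move=> cd Ic Id; have [C C0 hC] := ultra_ext_bounded_near c d cd Ic Id.
exists C => // g M g0 gM.
have bg : bounded_support g by exists c, d, M.
apply: (cvgr_to_le (cvg_norm (ultra_ext_cvg _ bg))).
by apply: oU; apply: filterS hC => n; apply.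
Qed.

(** Nodes may lie outside [I], where [phi] is arbitrary; [g] is a representative of [phi] that
    vanishes there. Its interpolants, from some index on, converge to [phi] in D. *)
Lemma ultra_ext_test_cont g phi : test_cont a b phi -> bounded_support g ->
  {in ival a b, phi =1 g} -> ultra_ext g = f phi.
Proof.
move=> tphi bg phig; apply: cvg_lim; first exact: Rhausdorff.
(* As [U] refines [\oo], an ordinary limit is enough. *)
apply: (cvg_trans (cvg_app _ oU)).
have [c [d [M [cd Ic Id g0 gM]]]] := bg.
have [c' [d' [cd' sub near0]]] := vanishes_interpolate c d Ic Id cd.
(* Continuity of [f] concerns sequences lying wholly in D with supports in one interval, so the
   first [N] interpolants are dropped. *)
have [N _ hN] : \forall n \near \oo, vanishes_off c' d' (interpolate n g).
  by apply: filterS near0 => n; apply.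
have testN n : test_cont a b (interpolate (n + N) g).
  apply: (test_cont_vanishes c' d') => //; first exact: continuous_interpolate.
  by apply: hN; rewrite /= leq_addl.
rewrite -(cvg_shiftn N).
have [_ _ /(_ (fun n => interpolate (n + N) g) phi testN tphi)] := hf.
apply; split; last first.
  exists c', d'; split => // n; apply: supp_real_vanishes => //.
  by apply: hN; rewrite /= leq_addl.
apply: cvg_uniform_norm => e e0.
(* The open set [I] is a neighbourhood of each point of [[c, d]], and [g] equals [phi] on it, so
   continuity within [I] becomes plain continuity of [g]. *)
have gc x : x \in `[c, d] -> {for x, continuous g}.
  move=> xcd; have Ix : ival a b x by apply: (ival_itv c d).
  have : phi y @[y --> x] --> phi x.
    have := (subspace_continuousP _ _).1 tphi.1 x Ix.
    by rewrite within_interior//; exact: ival_near.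
  rewrite phig ?inE//; apply: cvg_trans; apply: near_eq_cvg.
  by apply: filterS (ival_near x Ix) => y Iy; rewrite phig// inE.
have unif := unif_continuous_vanishes c d g e g0 gc e0.
have [K _ hK] := unif.
near=> n => x Ix; rewrite phig ?inE//.
apply: interpolate_dist; first exact: ltW.
- have [xcd|/g0 ->] := boolP (x \in `[c, d]); [left|by right].
  (* Once [n] exceeds this bound, the grid covers [[c, d]]. *)
  apply: (@le_trans _ _ (`|c| + `|d|)).
    move: xcd; rewrite in_itv /= => /andP[cx xd].
    have := ler_norm d; have := ler_norm (- c); rewrite normrN ler_norml.
    by have := normr_ge0 c; have := normr_ge0 d; lra.
  apply: (@le_trans _ _ n%:R); last by rewrite ler_nat -addnS leq_addr.
  near: n; exact: nbhs_infty_ger.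
- move=> y xy; rewrite distrC; apply: hK xy => /=.
  by rewrite (leq_trans _ (leq_addr _ _))//; near: n; exact: nbhs_infty_ge.
Unshelve. all: end_near. Qed.

End UltraLimit.

(** * The trace of a dynamic function: one real value at each time *)

Section Trace.
Context {R : realType} (a b : \bar R).
Implicit Types (phi psi : R -> R -> R) (c d l s t tau M e : R).

(* The one-sided limit -1/2+ is an arbitrary choice. *)
Definition trace phi t : R :=
  if t \in ival a b then xget 0 [set l | right_lim_at (phi t) (- 2^-1) l] else 0.

Lemma right_lim_at_unique (h : R -> R) s l l' :
  right_lim_at h s l -> right_lim_at h s l' -> l = l'.
Proof. by move=> [_ hl] [_ hl']; apply: (cvg_unique (@Rhausdorff R) hl hl'). Qed.

Lemma supJ_ge (h : R -> R) s l : right_lim_at h s l -> (`|l|%:E <= supJ h)%E.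
Proof. by move=> hl; apply: ereal_sup_ubound; exists l => //; exists s; left. Qed.

Lemma sup_dyn_ge (A : set R) phi t : A t -> (supJ (phi t) <= sup_dyn A phi)%E.
Proof. by move=> At; apply: ereal_sup_ubound; exists t. Qed.

Lemma traceE phi t l : ival a b t -> right_lim_at (phi t) (- 2^-1) l ->
  trace phi t = l.
Proof.
move=> It hl; rewrite /trace mem_set//; apply: xget_unique => // l' hl'.
exact: right_lim_at_unique hl' hl.
Qed.

Lemma trace_out phi t : ~ ival a b t -> trace phi t = 0.
Proof. by move=> It; rewrite /trace memNset. Qed.

Lemma traceP phi t : ival a b t -> regulated (phi t) ->
  right_lim_at (phi t) (- 2^-1) (trace phi t).
Proof.
move=> It [/(_ (- 2^-1))[|l hl _]]; last by rewrite (traceE phi t l).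
by rewrite lexx gtrN.
Qed.

Lemma trace_ordinary_dyn (phi : R -> R) t : ival a b t ->
  trace (ordinary_dyn phi) t = phi t.
Proof.
move=> It; apply: traceE => //; split; last exact: cvg_cst.
by rewrite lexx gtrN.
Qed.

Lemma trace_eq_dynamic phi psi :
  eq_dynamic a b phi psi -> trace phi = trace psi.
Proof.
move=> eqpp; apply/funext => t; rewrite /trace; case: ifPn => // /set_mem It.
congr xget; apply/seteqP.
by split=> l /= hl; apply/(eqpp t It (- 2^-1) l).1.
Qed.

Lemma trace_lin k phi psi :
  (forall t, ival a b t -> regulated (phi t)) ->
  (forall t, ival a b t -> regulated (psi t)) ->
  trace (fun t s => k * phi t s + psi t s) = fun t => k * trace phi t + trace psi t.
Proof.
move=> rphi rpsi; apply/funext => t.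
have [It|It] := pselect (ival a b t); last first.
  by rewrite !trace_out// mulr0 addr0.
have [hs hl] := traceP _ _ It (rphi _ It); have [_ hl'] := traceP _ _ It (rpsi _ It).
apply: traceE => //; split => //.
by apply: cvgD => //; apply: cvgM => //; exact: cvg_cst.
Qed.

(** The maximum with 0 covers times outside [I]: both traces vanish there, while the norm, as a
    supremum, is [-oo] when [I] is empty. *)
Lemma trace_dist_norm phi psi t :
  (forall t, ival a b t -> regulated (phi t)) ->
  (forall t, ival a b t -> regulated (psi t)) ->
  (`|trace phi t - trace psi t|%:E <=
     maxe 0 (norm_dG a b (fun t s => (phi t s - psi t s)%R)))%E.
Proof.
move=> rphi rpsi; have [It|It] := pselect (ival a b t); last first.
  by rewrite !trace_out// subrr normr0 le_max lexx.
rewrite le_max; apply/orP; right.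
have [hs hl] := traceP _ _ It (rphi _ It); have [_ hl'] := traceP _ _ It (rpsi _ It).
apply: le_trans (sup_dyn_ge _ (fun t s => phi t s - psi t s) t It).
by apply: (supJ_ge _ (- 2^-1)); split => //; exact: cvgB.
Qed.

Lemma trace_supp phi t : ~ supp_dyn a b phi t -> trace phi t = 0.
Proof.
move=> nst; have [It|/trace_out//] := pselect (ival a b t).
have [c hc] : exists c, ordinary_value (phi t) c.
  apply: contrapT => nc; apply: nst; split => //.
  by apply: subset_closure; split => //; left.
have c0 : c = 0.
  apply: contrapT => c0; apply: nst; split => //.
  by apply: subset_closure; split => //; right; exists c.
rewrite -c0; apply: traceE => //; apply/(hc (- 2^-1) c).1.
by split; [rewrite lexx gtrN|exact: cvg_cst].
Qed.

Lemma trace_norm_sup_dyn (A : set R) phi c t :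
  A t -> ival a b t -> regulated (phi t) ->
  (sup_dyn A (fun t s => (phi t s - c)%R) < 1%:E)%E ->
  `|trace phi t| <= `|c| + 1.
Proof.
move=> At It rt sup1; rewrite addrC -lerBlDr (le_trans (lerB_dist _ _))//.
rewrite -lee_fin; apply: le_trans (ltW sup1).
apply: le_trans (sup_dyn_ge _ (fun t s => phi t s - c) _ At).
have [hs hl] := traceP _ _ It rt.
by apply: (supJ_ge _ (- 2^-1)); split => //; apply: cvgB => //; exact: cvg_cst.
Qed.

Lemma trace_locally_bounded phi tau : dG a b phi -> ival a b tau ->
  exists M, \forall t \near tau, `|trace phi t| <= M.
Proof.
move=> [reg _ _ /(_ tau) lims] Itau.
have [[c /(_ _ ltr01)[r [r0 rI rsup]]] [c' /(_ _ ltr01)[r' [r'0 r'I r'sup]]]] := lims Itau.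
(* The limits from the two sides say nothing about the time [tau] itself, whose trace enters
   separately; the final 1 is the tolerance used for both limits. *)
exists (`|c| + `|c'| + `|trace phi tau| + 1).
have rr0 : 0 < Num.min r r' by rewrite lt_min r0.
apply/nbhs_ballP; exists (Num.min r r') => //= t.
rewrite /ball /= lt_min !ltr_norml => /andP[/andP[h1 h2] /andP[h3 h4]].
have c0 := normr_ge0 c; have c'0 := normr_ge0 c'; have t0 := normr_ge0 (trace phi tau).
have [ttau|taut|->] := ltgtP t tau; last by lra.
- have At : left_nbhd tau%:E r' t by rewrite /= in_itv /=; apply/andP; split; lra.
  have := trace_norm_sup_dyn _ phi c' t At (r'I _ At) (reg _ (r'I _ At)) r'sup; lra.
- have At : right_nbhd tau%:E r t by rewrite /= in_itv /=; apply/andP; split; lra.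
  have := trace_norm_sup_dyn _ phi c t At (rI _ At) (reg _ (rI _ At)) rsup; lra.
Qed.

(** A bound tending to [+oo] eventually exceeds each local bound, and compactness makes this uniform
    over [K]. *)
Lemma locally_bounded_compact (K : set R) (g : R -> R) : compact K ->
  (forall x, K x -> exists M, \forall y \near x, `|g y| <= M) ->
  exists M, forall x, K x -> `|g x| <= M.
Proof.
move=> cK gM.
suff : \forall M \near +oo, K `<=` [set x | `|g x| <= M].
  by move=> /filter_ex[M hM]; exists M.
apply: (compact_near_coveringP _).1 => // x /gM[M hM].
exists ([set y | `|g y| <= M], [set M' | M < M']).
  by split; [exact: hM|apply: nbhs_pinfty_gt; exact: num_real].
by case=> y M' [/= gy MM']; rewrite (le_trans gy)// ltW.
Qed.

Lemma ival_ex : (a < b)%E -> exists t, ival a b t.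
Proof.
case: a b => [r| |] [s| |]//; rewrite /ival /=.
- by rewrite lte_fin => rs; exists ((r + s) / 2); rewrite !lte_fin; apply/andP; split; lra.
- by move=> _; exists (r + 1); rewrite lte_fin ltrDl ltr01 ltry.
- by move=> _; exists (s - 1); rewrite lte_fin gtrBl ltr01 ltNyr.
- by move=> _; exists 0; rewrite ltry ltNyr.
Qed.

(** The endpoints are the minimum and maximum of [K], which belong to [K] and hence to [I]; an empty
    [K] gets a degenerate interval [[t, t]]. *)
Lemma compact_sub_itv (K : set R) : (a < b)%E -> compact K -> K `<=` ival a b ->
  exists c d, [/\ c <= d, ival a b c, ival a b d & K `<=` `[c, d]].
Proof.
move=> ab cK KI; have [K0|K0] := pselect (K !=set0); last first.
  have [t It] := ival_ex ab; exists t, t; split => // x Kx.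
  by exfalso; apply: K0; exists x.
have cid : {within K, continuous (@id R)}.
  by apply: continuous_subspaceT => x; exact: cvg_id.
have [c /set_mem Kc hc] := compact_EVT_min K0 cK cid.
have [d /set_mem Kd hd] := compact_EVT_max K0 cK cid.
exists c, d; split; [exact/hc/mem_set|exact: KI|exact: KI|].
by move=> x Kx /=; rewrite in_itv /= hc ?hd ?inE.
Qed.

Lemma trace_bounded_support phi : (a < b)%E -> test_dyn a b phi ->
  bounded_support a b (trace phi).
Proof.
move=> ab [dphi cphi]; have [|c [d [cd Ic Id sub]]] := compact_sub_itv _ ab cphi.
  by move=> ? [].
have subI := ival_itv c d Ic Id.
have [M hM] : exists M, forall x, x \in `[c, d] -> `|trace phi x| <= M.
  apply: (locally_bounded_compact [set` `[c, d]]); first exact: segment_compact.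
  by move=> x /subI; exact: trace_locally_bounded.
have v0 : vanishes_off c d (trace phi).
  by move=> x xn; apply: trace_supp => /sub; exact/negP.
exists c, d, M; split => // x.
have [/hM//|xn] := boolP (x \in `[c, d]); rewrite v0// normr0.
by apply: le_trans (hM c _); rewrite // in_itv /= lexx.
Qed.

End Trace.

(** * Extension of [f] from D to T through the trace *)

Theorem theorem3 (R : realType) (a b : \bar R) (ab : (a < b)%E)
    (f : (R -> R) -> R) (hf : distr_cont a b f) :
  exists F : (R -> R -> R) -> R,
    distr_dyn a b F /\
    forall phi : R -> R, test_cont a b phi -> F (ordinary_dyn phi) = f phi.
Proof.
have [U [UU oU]] := ultraFilterLemma (_ : ProperFilter \oo).
exists (fun phi => ultra_ext f U (trace a b phi)); split; last first.
  move=> phi tphi; apply: (ultra_ext_test_cont a b f U hf UU oU) => //.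
    exact/trace_bounded_support/ordinary_test_dyn.
  by move=> t; rewrite inE => It; rewrite trace_ordinary_dyn.
have reg phi : test_dyn a b phi -> forall t, ival a b t -> regulated (phi t).
  by case=> -[].
split=> [phi psi _ _ /trace_eq_dynamic -> //|k phi psi tphi tpsi|phi_ phi tphi_ tphi].
  rewrite trace_lin; [|exact: reg|exact: reg].
  by apply: (ultra_ext_lin a b f U hf UU oU); exact: trace_bounded_support.
move=> [cvg [c [d [cd cdI supp]]]].
have bphi := trace_bounded_support _ _ _ ab tphi.
have [c0 [d0 [M [cd0 Ic0 Id0 v0 _]]]] := bphi.
have Icd : ival a b c /\ ival a b d.
  by split; apply: cdI; rewrite /= in_itv /= lexx cd.
(* [[c, d]] contains the supports of all [phi_ n], and the trace of [phi] vanishes off [[c0, d0]];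
   the difference of traces needs an interval containing both. *)
pose c' := Num.min c c0; pose d' := Num.max d d0.
have Ic' : ival a b c' by rewrite /c'; case: leP => _ //; case: Icd.
have Id' : ival a b d' by rewrite /d'; case: leP => _ //; case: Icd.
have cd' : c' <= d' by rewrite ge_min le_max cd.
have [C C0 hC] := ultra_ext_bounded a b f U hf UU oU c' d' cd' Ic' Id'.
apply/cvgrPdist_le => e e0.
(* [C] may be 0, hence the denominator [C + 1]. *)
have e'0 : 0 < e / (C + 1) by rewrite divr_gt0// ltr_wpDl.
have : \forall n \near \oo,
    (norm_dG a b (fun t s => (phi_ n t s - phi t s)%R) < (e / (C + 1))%:E)%E.
  apply: (cvg [set x | (x < (e / (C + 1))%:E)%E]); apply: open_nbhs_nbhs.
  split; last by rewrite /= lte_fin.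
  exact: open_ereal_lt_ereal.
apply: filterS => n hn.
(* Linearity is available in the form [k * g + h], so the difference is taken with [k = -1] and the
   opposite sign. *)
have -> : ultra_ext f U (trace a b phi) - ultra_ext f U (trace a b (phi_ n)) =
    - ultra_ext f U (fun t => -1 * trace a b phi t + trace a b (phi_ n) t).
  rewrite (ultra_ext_lin a b f U hf UU oU)//; last exact: trace_bounded_support.
  by rewrite mulN1r opprD opprK.
rewrite normrN (le_trans (hC _ (e / (C + 1)) _ _))//.
- move=> t tn.
  have tn0 : t \notin `[c0, d0].
    apply: contra tn; rewrite !in_itv /= ge_min le_max => /andP[-> ->].
    by rewrite !orbT.
  rewrite v0// mulr0 add0r; apply: trace_supp => /supp.
  apply/negP; apply: contra tn; rewrite !in_itv /= ge_min le_max.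
  by move=> /andP[-> ->].
- move=> t; rewrite mulN1r addrC -lee_fin.
  apply: (le_trans (trace_dist_norm _ _ _ _ t (reg _ (tphi_ n)) (reg _ tphi))).
  by rewrite ge_max lee_fin !ltW.
- by rewrite mulrA ler_pdivrMr ?ltr_wpDl// mulrC ler_wpM2l ?lerDl// ltW.
Qed.
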